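(* Let $\mathcal{L}:\mathbb{R}^d\to\mathbb{R}$ be differentiable, bounded below by a constant $\mathcal{L}^*$, and with $\nabla\mathcal{L}$ Lipschitz continuous with constant $L$. Run full-batch MoFO (as defined in the context) from an arbitrary initial point $\theta_0\in\mathbb{R}^d$ with hyperparameters $0<\beta_1<\sqrt{\beta_2}<1$ and learning rate schedule $\eta_t=\eta/\sqrt{t}$ for some $\eta>0$. Then $$\min_{0\le t\le T-1}\|\nabla\mathcal{L}(\theta_t)\|_\infty=\mathcal{O}\!\left(\frac{\log T}{\sqrt{T}}\right)\quad\text{as } T\to\infty.$$
   Context: The coordinates of $\mathbb{R}^d$ are partitioned into $B$ blocks of sizes $d_1,\dots,d_B$ with $\sum_k d_k=d$; write $z=(z^{(1)},\dots,z^{(B)})$ with $z^{(k)}\in\mathbb{R}^{d_k}$. Fix an update fraction $\alpha\%\in(0,1]$. For $z\in\mathbb{R}^d$, the top-$\alpha\%$ filter $\texttt{FLT}_\alpha(z)\in\{0,1\}^d$ is defined blockwise: in block $k$ it equals $1$ exactly on a set $S_k$ of $\lceil d_k\cdot\alpha\%\rceil$ indices $i$ whose values $|z^{(k)}_i|$ are the largest in that block (ties broken in favour of smaller indices), and $0$ elsewhere. Full-batch MoFO with hyperparameters $\beta_1,\beta_2\in(0,1)$, learning rates $\eta_t>0$ and initial point $\theta_0$: set $m_0=v_0=0\in\mathbb{R}^d$; for $t\ge1$, $g_t=\nabla\mathcal{L}(\theta_{t-1})$, $m_t=\beta_1m_{t-1}+(1-\beta_1)g_t$, $v_t=\beta_2v_{t-1}+(1-\beta_2)g_t\odot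 g_t$, $\hat m_t=m_t/(1-\beta_1^t)$, $\hat v_t=v_t/(1-\beta_2^t)$, and $\theta_t=\theta_{t-1}-\eta_t\,(\hat m_t\odot\texttt{FLT}_\alpha(m_t))/\sqrt{\hat v_t}$ (entrywise division, no $\epsilon$ term; if $\hat v_{i,t}=0$ then $\hat m_{i,t}=0$ and the corresponding quotient is taken to be $0$). $\odot$ is the entrywise product. *)

(* Defs.v *)
From HB Require Import structures.
From mathcomp Require Import all_boot all_order all_algebra.
From mathcomp Require Import all_classical all_reals all_analysis.
Set Implicit Arguments. Unset Strict Implicit. Unset Printing Implicit Defensive.
Import Order.TTheory GRing.Theory Num.Theory.
Import numFieldNormedType.Exports.
Local Open Scope ring_scope.

Section MoFO.
Variables (R : realType) (d B : nat).

Definition l2norm (x : 'rV[R]_d) : R := Num.sqrt (\sum_(i < d) x 0 i ^+ 2).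

Definition linfnorm (x : 'rV[R]_d) : R := \big[Num.max/0]_(i < d) `|x 0 i|.

(* Blocks: blk i is the block containing coordinate i.
   Rank of coordinate i inside its block for the strict order
   "larger |z_j| first, ties broken in favour of smaller index". *)
Definition blk_rank (blk : 'I_d -> 'I_B) (z : 'rV[R]_d) (i : 'I_d) : nat :=
  #|[set j : 'I_d | (blk j == blk i) &&
       ((`|z 0 i| < `|z 0 j|) || ((`|z 0 j| == `|z 0 i|) && (j < i)%N))]|.

Definition blk_size (blk : 'I_d -> 'I_B) (k : 'I_B) : nat :=
  #|[set j : 'I_d | blk j == k]|.

(* Top-alpha% filter: in block k, 1 exactly on the ceil(d_k * alpha)
   coordinates with the largest |z_i| (ties to smaller indices). *)
Definition FLT (blk : 'I_d -> 'I_B) (alpha : R) (z : 'rV[R]_d) : 'rV[R]_d :=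
  \row_i (if ((blk_rank blk z i)%:Z < Num.ceil ((blk_size blk (blk i))%:R * alpha))%R
          then 1 else 0).

(* One MoFO step at iteration t >= 1, from state (theta_{t-1}, m_{t-1}, v_{t-1}). *)
Definition mofo_step (grad : 'rV[R]_d -> 'rV[R]_d) (blk : 'I_d -> 'I_B)
  (alpha beta1 beta2 : R) (lr : nat -> R) (t : nat)
  (s : 'rV[R]_d * 'rV[R]_d * 'rV[R]_d) : 'rV[R]_d * 'rV[R]_d * 'rV[R]_d :=
  let: (theta, m, v) := s in
  let g := grad theta in
  let m' := beta1 *: m + (1 - beta1) *: g in
  let v' := beta2 *: v + (1 - beta2) *: \row_i (g 0 i ^+ 2) in
  let mhat := (1 - beta1 ^+ t)^-1 *: m' in
  let vhat := (1 - beta2 ^+ t)^-1 *: v' in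
  let flt := FLT blk alpha m' in
  let upd := \row_i (if vhat 0 i == 0 then 0
                     else mhat 0 i * flt 0 i / Num.sqrt (vhat 0 i)) in
  (theta - lr t *: upd, m', v').

Fixpoint mofo (grad : 'rV[R]_d -> 'rV[R]_d) (blk : 'I_d -> 'I_B)
  (alpha beta1 beta2 : R) (lr : nat -> R) (theta0 : 'rV[R]_d) (n : nat)
  : 'rV[R]_d * 'rV[R]_d * 'rV[R]_d :=
  match n with
  | 0 => (theta0, 0, 0)
  | n'.+1 => mofo_step grad blk alpha beta1 beta2 lr n'.+1
               (mofo grad blk alpha beta1 beta2 lr theta0 n')
  end.

Definition mofo_theta grad blk alpha beta1 beta2 lr theta0 n : 'rV[R]_d :=
  (mofo grad blk alpha beta1 beta2 lr theta0 n).1.1.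

End MoFO.

(* Main.v *)
(* Since beta1 < sqrt beta2, |m_t| is controlled by sqrt v_t, so every coordinate
   of an update is O(eta_t) and, the gradient being Lipschitz, consecutive gradients
   differ by O(1/sqrt t).  Geometric averages of such a slowly varying sequence lag
   behind it by O(1/sqrt t) only: the debiased m_t is g_t + O(1/sqrt t), and
   sqrt v_t <= |g_t| + O(1/sqrt t).  Hence an updated coordinate decreases the loss by
   at least c eta_t |g_t| - O(1/t).  The filter always keeps a coordinate where |m_t|
   is maximal over all blocks, and there |g_t| is maximal up to O(1/sqrt t).  Summing
   the descent inequality bounds sum_t |g_t|_oo / sqrt t by O(log T), whereas the
   weights 1/sqrt t sum to at least sqrt T. *)
Require Import Defs.
From HB Require Import structures.
From mathcomp Require Import all_boot all_order all_algebra.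
From mathcomp Require Import all_classical all_reals all_analysis.
From mathcomp Require Import ring lra.
Set Implicit Arguments. Unset Strict Implicit. Unset Printing Implicit Defensive.
Import Order.TTheory GRing.Theory Num.Theory.
Import numFieldNormedType.Exports.
Local Open Scope ring_scope.

(** * Elementary rates: perturbed contractions and harmonic sums *)

Lemma invsqrt_le (R : rcfType) (a b c : R) : 0 < a -> 0 < b -> 0 <= c ->
  b <= c ^+ 2 * a -> (Num.sqrt a)^-1 <= c * (Num.sqrt b)^-1.
Proof.
move=> a0 b0 c0 bca; have sa : 0 < Num.sqrt a by rewrite sqrtr_gt0.
have sb : 0 < Num.sqrt b by rewrite sqrtr_gt0.
rewrite ler_pdivlMr// mulrC ler_pdivrMr//.
by rewrite -(ger0_norm c0) -sqrtr_sqr -sqrtrM ?sqr_ge0// ler_wsqrtr.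
Qed.

(** Both moving averages obey such a recursion for their lag behind the gradient. [D] is chosen
    before [f], so one constant serves all coordinates. *)
Lemma smoothing_rate (R : realType) (rho K : R) : 0 <= rho < 1 -> 0 <= K ->
  exists2 D : R, 0 <= D & forall f : nat -> R, f 0%N <= 0 ->
    (forall n, f n.+1 <= rho * (f n + K / Num.sqrt n.+1%:R)) ->
    forall n, f n <= D / Num.sqrt n.+1%:R.
Proof.
move=> /andP[r0 r1] K0.
pose N : R := (Num.bound (1 - rho)^-1).+1%:R.
have N0 : 0 < N by rewrite ltr0n.
have N1 : 1 <= N by rewrite ler1n.
have Nr : 1 < N * (1 - rho).
  rewrite -ltr_pdivrMr ?subr_gt0// mul1r.
  apply: le_lt_trans (ler_norm _) _; apply: lt_trans (archi_boundP (normr_ge0 _)) _.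
  have r1i : 0 <= (1 - rho)^-1 by rewrite invr_ge0 subr_ge0 ltW.
  rewrite ger0_norm//.
  by rewrite ltr_nat ltnS leqnn.
pose q := rho * (N + 1) / N.
have q0 : 0 <= q.
  apply: divr_ge0; last exact: ltW.
  by apply: mulr_ge0 => //; lra.
have q1 : q < 1 by rewrite ltr_pdivrMr// mul1r; lra.
have sN0 := sqrtr_ge0 N.
(* [D] is the fixed point of [D = q * (D + K * Num.sqrt N)]; the factor [Num.sqrt N] comes from
   replacing [1/sqrt (n + 1)] by [1/sqrt (n + N)]. *)
pose D := q * (K * Num.sqrt N) / (1 - q).
have D0 : 0 <= D.
  by apply: divr_ge0; [apply: mulr_ge0 => //; exact: mulr_ge0 | lra].
have DE : q * (D + K * Num.sqrt N) = D by rewrite /D; field; lra.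
(* A bound of order 1/sqrt (n + N) propagates because the choice of N makes
   rho * sqrt ((n + 1 + N) / (n + N)) stay below q < 1. *)
exists D => // f f0 fS n.
have pos i : 0 < i%:R + N by rewrite ltr_wpDl.
suff fn : f n <= D / Num.sqrt (n%:R + N).
  apply: le_trans fn _; rewrite ler_wpM2l//.
  rewrite -[leRHS]mul1r; apply: invsqrt_le => //.
  by rewrite expr1n mul1r -natr1 lerD2l.
elim: n => [|n IH]; first by apply: le_trans f0 _; rewrite divr_ge0 ?sqrtr_ge0.
apply: le_trans (fS n) _.
have n0 : 0 <= n%:R :> R by [].
have h1 : (Num.sqrt n.+1%:R)^-1 <= Num.sqrt N * (Num.sqrt (n%:R + N))^-1.
  apply: invsqrt_le => //; rewrite sqr_sqrtr ?(ltW N0)// -natr1.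
  by rewrite mulrDr mulr1 lerD2r ler_peMl.
have h2 : (Num.sqrt (n%:R + N))^-1 <= (N + 1) / N * (Num.sqrt (n.+1%:R + N))^-1.
  apply: invsqrt_le => //; first by rewrite divr_ge0// ?addr_ge0// ltW.
  rewrite expr_div_n mulrAC ler_pdivlMr ?exprn_gt0// -natr1.
  rewrite -subr_ge0 [leRHS](_ : _ = n%:R * (2 * N + 1) + N * (N + 1)); last by ring.
  by rewrite addr_ge0 ?mulr_ge0 ?addr_ge0 ?mulr_ge0// ltW.
apply: (@le_trans _ _ (rho * ((D + K * Num.sqrt N) * (Num.sqrt (n%:R + N))^-1))).
  rewrite ler_wpM2l// mulrDl lerD// -mulrA.
  by rewrite ler_wpM2l.
apply: (@le_trans _ _
   (rho * ((D + K * Num.sqrt N) * ((N + 1) / N * (Num.sqrt (n.+1%:R + N))^-1)))).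
  by rewrite ler_wpM2l// ler_wpM2l// addr_ge0// mulr_ge0.
by rewrite -[in leRHS]DE /q le_eqVlt; apply/orP; left; apply/eqP; ring.
Qed.

(** Each new term is at most an increment of the logarithm, by [ln (1 + x) <= x] at
    [x = - 1/(n + 2)]. *)
Lemma harmonic_le_ln (R : realType) (n : nat) :
  \sum_(i < n.+1) i.+1%:R^-1 <= 1 + ln (n.+1%:R : R).
Proof.
elim: n => [|n IH]; first by rewrite big_ord_recr big_ord0 /= add0r invr1 ln1 addr0.
rewrite big_ord_recr /=; apply: le_trans (lerD IH (lexx _)) _.
rewrite -addrA lerD2l -lerBrDl.
have p1 : 0 < n.+1%:R :> R by [].
have p2 : 0 < n.+2%:R :> R by [].
rewrite -opprB lerNr -ln_div ?posrE//.
have -> : n.+1%:R / n.+2%:R = 1 + - n.+2%:R^-1 :> R.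
  by rewrite -[in LHS](addrK 1 n.+1%:R) natr1 mulrBl divff ?lt0r_neq0// mul1r.
apply: le_ln1Dx; rewrite ltrN2 invf_lt1// ltr1n//.
Qed.

(** * Norm comparisons and the descent inequality *)

Lemma l2norm_le (R : realType) (d : nat) (x : 'rV[R]_d) (M : R) : 0 <= M ->
  (forall i, `|x 0 i| <= M) -> l2norm x <= d%:R * M.
Proof.
move=> M0 xM; rewrite /l2norm -[leRHS]ger0_norm ?mulr_ge0// -sqrtr_sqr.
apply: ler_wsqrtr; apply: (@le_trans _ _ (\sum_(i < d) M ^+ 2)).
  by apply: ler_sum => i _; rewrite -real_normK ?num_real// lerXn2r ?nnegrE.
rewrite sumr_const card_ord -[leLHS]mulr_natl exprMn ler_wpM2r ?sqr_ge0//.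
by rewrite -natrX ler_nat; case: d {x xM} => // d; rewrite leq_pmulr.
Qed.

Lemma coord_le_l2norm (R : realType) (d : nat) (x : 'rV[R]_d) (i : 'I_d) :
  `|x 0 i| <= l2norm x.
Proof.
rewrite -sqrtr_sqr; apply: ler_wsqrtr.
by rewrite (bigD1 i)//= lerDl sumr_ge0// => j _; rewrite sqr_ge0.
Qed.

(** Turns the Euclidean Lipschitz condition into a coordinatewise one, at the cost of a factor [d].
    The absolute value is there because [L] may be negative when [d = 0]. *)
Lemma lipschitz_coord (R : realType) (d : nat) (grad : 'rV[R]_d -> 'rV[R]_d) (L : R) :
  (forall x y : 'rV[R]_d, l2norm (grad x - grad y) <= L * l2norm (x - y)) ->
  forall (x y : 'rV[R]_d) (M : R), 0 <= M -> (forall i, `|x 0 i - y 0 i| <= M) ->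
  forall i, `|grad x 0 i - grad y 0 i| <= `|L| * d%:R * M.
Proof.
move=> gL x y M M0 xy i.
have := coord_le_l2norm (grad x - grad y) i; rewrite !mxE => /le_trans; apply.
apply: le_trans (gL x y) _; rewrite -mulrA.
apply: (@le_trans _ _ (`|L| * l2norm (x - y))).
  by rewrite ler_wpM2r ?ler_norm// sqrtr_ge0.
by rewrite ler_wpM2l// l2norm_le// => j; rewrite !mxE.
Qed.

Lemma is_derive_line (R : realType) (V : normedModType R) (f : V -> R) (x h : V) (s : R) :
  differentiable f (x + s *: h) ->
  is_derive s (1 : R) (fun t : R => f (x + t *: h)) ('d f (x + s *: h) h).
Proof.
move=> df.
have E : (fun t : R => t^-1 *: (((fun t => f (x + t *: h)) \o shift s) (t *: (1:R)) - f (x + s *: h)))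
   = (fun t : R => t^-1 *: ((f \o shift (x + s *: h)) (t *: h) - f (x + s *: h))).
  apply/funext => t /=; congr (_ *: (f _ - _)).
  by rewrite [t *: _]mulr1 scalerDl addrCA addrA addrC addrA addrAC.
have /derivableP := diff_derivable (v := h) df.
rewrite deriveE// => -[cf vf]; apply: DeriveDef.
  by rewrite /derivable E.
by rewrite /derive E -vf.
Qed.

(** The mean value theorem on the segment from [x] to [x + h] yields the gradient at one
    intermediate point, and each of its coordinates is within [|L| * d * M] of that at [x]. The
    resulting constant is cruder than the usual [L/2], which does not affect the rate. *)
Lemma descent (R : realType) (d : nat) (Loss : 'rV[R]_d -> R)
    (grad : 'rV[R]_d -> 'rV[R]_d) (L : R) :
  (forall x : 'rV[R]_d, differentiable Loss x) ->
  (forall x h : 'rV[R]_d, 'd Loss x h = \sum_(i < d) grad x 0 i * h 0 i) ->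
  (forall x y : 'rV[R]_d, l2norm (grad x - grad y) <= L * l2norm (x - y)) ->
  forall (x h : 'rV[R]_d) (M : R), 0 <= M -> (forall i, `|h 0 i| <= M) ->
  Loss (x + h) <= Loss x + \sum_(i < d) grad x 0 i * h 0 i + `|L| * d%:R ^+ 2 * M ^+ 2.
Proof.
move=> dL gE gL x h M M0 hM.
have D (s : R) : is_derive s (1 : R) (fun t : R => Loss (x + t *: h))
   (\sum_(i < d) grad (x + s *: h) 0 i * h 0 i).
  by rewrite -gE; apply: is_derive_line.
have [c c01] := MVT ltr01 (fun s _ => D s)
  (derivable_within_continuous (fun s _ => @ex_derive _ _ _ _ _ _ _ (D s))).
rewrite subr0 mulr1 scale1r scale0r addr0 => /eqP; rewrite subr_eq => /eqP ->.
rewrite addrC -addrA lerD2l -lerBlDl -sumrB.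
apply: (@le_trans _ _ (\sum_(i < d) `|L| * d%:R * M * M)).
  apply: ler_sum => i _; rewrite -mulrBl; apply: le_trans (ler_norm _) _.
  rewrite normrM ler_pM// (lipschitz_coord gL)// => j.
  rewrite !mxE addrAC subrr add0r normrM.
  move: c01; rewrite in_itv /= => /andP[/ltW c0 /ltW c1].
  by rewrite ger0_norm// -[leRHS]mul1r ler_pM.
by rewrite sumr_const card_ord -mulr_natl le_eqVlt; apply/orP; left; apply/eqP; ring.
Qed.

(** * The filter keeps a globally maximal coordinate *)

(** Among the maximizers of [|z|] over all blocks, the one of smallest index has rank 0 in its
    block, and the ceiling of a positive number is positive. The index [j] only witnesses
    [d > 0]. *)
Lemma FLT_some_argmax (R : realType) (d B : nat) (blk : 'I_d -> 'I_B) (alpha : R)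
    (z : 'rV[R]_d) (j : 'I_d) : 0 < alpha ->
  exists i, FLT blk alpha z 0 i = 1 /\ forall k, `|z 0 k| <= `|z 0 i|.
Proof.
move=> a0.
have [i0 _ zi0] := Order.TotalTheory.arg_maxP (fun k => `|z 0 k|) (erefl (xpredT j)).
have [i /forallP zi imin] := @arg_minnP _ i0 [pred i | [forall k, `|z 0 k| <= `|z 0 i|]]
  (@nat_of_ord d) (introT forallP (fun k => zi0 k isT)).
exists i; split=> [|k]; last exact: zi.
rewrite mxE /blk_rank (_ : [set _ | _] = finset.set0) ?cards0; last first.
  apply/setP => k; rewrite !inE; apply/negP => /andP[_ /orP[]].
    by rewrite ltNge zi.
  move=> /andP[/eqP zk]; rewrite ltnNge imin//=.
  by apply/forallP => l; rewrite zk.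
rewrite ceil_gt0 mulr_gt0// ltr0n /blk_size card_gt0.
by apply/finset.set0Pn; exists i; rewrite inE.
Qed.

(** * Exponential moving averages and their lag *)

(** One coordinate of a moment. The index is shifted: [g n] is the gradient at the iterate [n] and
    enters the moment [n.+1]. *)
Definition ema (R : pzRingType) (beta : R) (g m : nat -> R) :=
  m 0%N = 0 /\ forall n, m n.+1 = beta * m n + (1 - beta) * g n.

Lemma ema_ge0 (R : numDomainType) (beta : R) (g m : nat -> R) :
  0 <= beta <= 1 -> (forall n, 0 <= g n) -> ema beta g m -> forall n, 0 <= m n.
Proof.
move=> /andP[b0 b1] g0 [m0 mS]; elim=> [|n IH]; first by rewrite m0.
by rewrite mS addr_ge0// mulr_ge0// subr_ge0.
Qed.

(* beta1 < sqrt beta2 makes the ratio of consecutive weights of m smaller than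
   that of sqrt v, so that a geometric series controls m by sqrt v *)
Lemma ema_le_sqrt_ema (R : rcfType) (beta1 beta2 : R) :
  0 < beta1 -> beta1 < Num.sqrt beta2 -> beta2 < 1 ->
  exists2 c : R, 0 <= c & forall g m v : nat -> R,
    ema beta1 g m -> ema beta2 (fun n => g n ^+ 2) v ->
    forall n, `|m n| <= c * Num.sqrt (v n).
Proof.
move=> b1 b12 b2.
set s := Num.sqrt beta2 in b12; have s0 : 0 < s by exact: lt_trans b12.
have b20 : 0 < beta2 by rewrite -sqrtr_gt0.
have s1 : s < 1 by rewrite -sqrtr1 ltr_sqrt.
pose a := Num.sqrt (1 - beta2).
have a0 : 0 < a by rewrite sqrtr_gt0 subr_gt0.
have q1 : beta1 / s < 1 by rewrite ltr_pdivrMr// mul1r.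
(* [c] is the fixed point, recorded in [cE], of the recursion obtained from
   [sqrt v_{n+1} >= s * sqrt v_n] and [sqrt v_{n+1} >= a * |g_n|]. *)
pose c := (1 - beta1) / a / (1 - beta1 / s).
have c0 : 0 <= c.
  by apply: divr_ge0; [apply: divr_ge0; [lra | exact: ltW] | lra].
have cE : beta1 * c / s + (1 - beta1) / a = c.
  rewrite /c; field; rewrite !(gt_eqF a0) !(gt_eqF s0)/= subr_eq0 gt_eqF//.
clearbody c; exists c => // g m v [m0 mS] hv.
have v0 n : 0 <= v n.
  by apply: ema_ge0 hv n => [|n]; rewrite ?sqr_ge0// (ltW b20) ltW.
case: hv => _ vS; elim=> [|n IH]; first by rewrite m0 normr0 mulr_ge0// sqrtr_ge0.
set W := Num.sqrt (v n.+1).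
have h1 : Num.sqrt (v n) <= W / s.
  rewrite ler_pdivlMr// mulrC -sqrtrM ?(ltW b20)//; apply: ler_wsqrtr.
  by rewrite vS lerDl mulr_ge0 ?sqr_ge0// subr_ge0 ltW.
have h2 : `|g n| <= W / a.
  rewrite ler_pdivlMr// mulrC -sqrtr_sqr -sqrtrM ?subr_ge0 ?(ltW b2)//.
  by apply: ler_wsqrtr; rewrite vS lerDr mulr_ge0// ltW.
rewrite mS; apply: le_trans (ler_normD _ _) _.
rewrite !normrM (gtr0_norm b1) [`|1 - _|]gtr0_norm; last by rewrite subr_gt0 (lt_trans b12).
rewrite -[in leRHS]cE [leRHS]mulrDl lerD//.
  rewrite -!mulrA ler_pM2l//; apply: le_trans IH _.
  by rewrite ler_wpM2l// [_^-1 * _]mulrC.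
by rewrite -mulrA [_^-1 * _]mulrC ler_wpM2l// subr_ge0 ltW// (lt_trans b12).
Qed.

(** The weights in [m n.+1] sum to [1 - beta ^+ n.+1], hence the comparison with that multiple of
    [g n]. The error is multiplied by [beta] after absorbing the drift of [g], so [smoothing_rate]
    applies. *)
Lemma ema_lag (R : realType) (beta K : R) : 0 <= beta < 1 -> 0 <= K ->
  exists2 D : R, 0 <= D & forall g m : nat -> R, ema beta g m ->
    (forall n, `|g n.+1 - g n| <= K / Num.sqrt n.+1%:R) ->
    forall n, `|m n.+1 - (1 - beta ^+ n.+1) * g n| <= D / Num.sqrt n.+1%:R.
Proof.
move=> b01 K0; have [D D0 hD] := smoothing_rate b01 K0.
exists D => // g m [m0 mS] gK; apply: hD => [|n].
  by rewrite mS m0 mulr0 add0r expr1 subrr normr0.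
have /andP[b0 b1] := b01.
rewrite [m n.+2]mS.
have -> : beta * m n.+1 + (1 - beta) * g n.+1 - (1 - beta ^+ n.+2) * g n.+1
  = beta * ((m n.+1 - (1 - beta ^+ n.+1) * g n) - (1 - beta ^+ n.+1) * (g n.+1 - g n)).
  by rewrite [beta ^+ n.+2]exprS; ring.
rewrite normrM ger0_norm// ler_wpM2l//; apply: le_trans (ler_normB _ _) _.
rewrite lerD2l normrM; apply: le_trans (gK n).
rewrite ler_piMl// ger0_norm ?subr_ge0 ?exprn_ile1// ?gerBl ?exprn_ge0// ltW//.
Qed.

(** The excess of [sqrt v] over [|g|] contracts by [s = sqrt beta]: for [a, G >= 0], [beta * (G +
    a)^2 + (1 - beta) * G^2 <= (G + s * a)^2]. An upper bound is what the denominator of the update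
    calls for. *)
Lemma sqrt_ema_lag (R : realType) (beta K : R) : 0 <= beta < 1 -> 0 <= K ->
  exists2 D : R, 0 <= D & forall g v : nat -> R, ema beta (fun n => g n ^+ 2) v ->
    (forall n, `|g n.+1 - g n| <= K / Num.sqrt n.+1%:R) ->
    forall n, Num.sqrt (v n.+1) <= `|g n| + D / Num.sqrt n.+1%:R.
Proof.
move=> /andP[b0 b1] K0; set s := Num.sqrt beta.
have s0 : 0 <= s by exact: sqrtr_ge0.
have s1 : s < 1 by rewrite -sqrtr1 ltr_sqrt.
have sb : s ^+ 2 = beta by rewrite sqr_sqrtr.
have s01 : 0 <= s < 1 by rewrite s0.
have [D D0 hD] := smoothing_rate s01 K0.
(* The positive part is needed: the estimate (G + a)^2 -> (G + s a)^2 below fails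
   for a < 0. *)
exists D => // g v hv gK n.
have v0 k : 0 <= v k.
  by apply: ema_ge0 hv k => [|k]; rewrite ?sqr_ge0// b0 ltW.
case: hv => vz vS.
pose f k := Num.max 0 (Num.sqrt (v k.+1) - `|g k|).
have f0 k : 0 <= f k by rewrite le_max lexx.
rewrite addrC -lerBlDr; apply: (@le_trans _ _ (f n)); first by rewrite le_max lexx orbT.
apply: hD => {n} [|n].
  rewrite ge_max lexx/= vS vz mulr0 add0r subr_le0 -sqrtr_sqr ler_wsqrtr//.
  by rewrite ler_piMl ?sqr_ge0// gerBl.
set a := f n + _.
have a0 : 0 <= a by rewrite addr_ge0// divr_ge0// sqrtr_ge0.
rewrite ge_max mulr_ge0//= lerBlDr.
have G0 := normr_ge0 (g n.+1); set G := `|g n.+1| in G0 *.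
have WG : Num.sqrt (v n.+1) <= G + a.
  have h1 : Num.sqrt (v n.+1) - `|g n| <= f n by rewrite le_max lexx orbT.
  have h3 : `|g n| <= G + K / Num.sqrt n.+1%:R.
    rewrite -lerBlDl; apply: le_trans (gK n); rewrite distrC.
    by apply: le_trans (lerB_dist _ _).
  rewrite /a; lra.
have R0 : 0 <= s * a + G by rewrite addr_ge0// mulr_ge0.
rewrite -[leRHS]ger0_norm// -sqrtr_sqr ler_wsqrtr// vS.
have -> : g n.+1 ^+ 2 = G ^+ 2 by rewrite /G real_normK// num_real.
have W2 : v n.+1 <= (G + a) ^+ 2.
  by rewrite -[leLHS]sqr_sqrtr// lerXn2r// nnegrE ?sqrtr_ge0// addr_ge0.
apply: (@le_trans _ _ (beta * (G + a) ^+ 2 + (1 - beta) * G ^+ 2)).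
  by rewrite lerD2r ler_wpM2l.
rewrite -sb -subr_ge0.
rewrite [leRHS](_ : _ = 2 * (s * (1 - s) * (a * G))); last by ring.
by rewrite !mulr_ge0// subr_ge0 ltW.
Qed.

(** * The unfiltered update direction of one coordinate *)

(** The quotient used at step [n.+1], without filter and learning rate, so that its estimates hold
    for every coordinate, selected or not. *)
Definition adam_dir (R : rcfType) (beta1 beta2 : R) (m v : nat -> R) (n : nat) : R :=
  let vhat := (1 - beta2 ^+ n.+1)^-1 * v n.+1 in
  if vhat == 0 then 0
  else (1 - beta1 ^+ n.+1)^-1 * m n.+1 / Num.sqrt vhat.

Lemma debias_bounds (R : numDomainType) (beta : R) (n : nat) : 0 <= beta < 1 ->
  1 - beta <= 1 - beta ^+ n.+1 <= 1.
Proof.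
move=> /andP[b0 b1]; rewrite gerBl exprn_ge0// andbT lerD2l lerN2 exprS.
by rewrite ler_piMr// exprn_ile1// ltW.
Qed.

(** The bound of [ema_le_sqrt_ema] survives debiasing: the numerator grows by a factor at most
    [1 / (1 - beta1)], and the denominator does not shrink. *)
Lemma adam_dir_bounded (R : rcfType) (beta1 beta2 : R) :
  0 < beta1 -> beta1 < Num.sqrt beta2 -> beta2 < 1 ->
  exists2 c : R, 0 <= c & forall g m v : nat -> R,
    ema beta1 g m -> ema beta2 (fun n => g n ^+ 2) v ->
    forall n, `|adam_dir beta1 beta2 m v n| <= c.
Proof.
move=> b1 b12 b2; have [c c0 hc] := ema_le_sqrt_ema b1 b12 b2.
have b20 : 0 < beta2 by rewrite -sqrtr_gt0 (lt_trans b1).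
have b11 : beta1 < 1 by rewrite (lt_trans b12)// -sqrtr1 ltr_sqrt.
have c1 : 0 <= c / (1 - beta1) by rewrite divr_ge0// subr_ge0 ltW.
exists (c / (1 - beta1)) => // g m v hm hv n; rewrite /adam_dir.
case: eqP => [_|/eqP vh0]; first by rewrite normr0.
have v0 : 0 <= v n.+1.
  by apply: ema_ge0 hv n.+1 => [|k]; rewrite ?sqr_ge0// (ltW b20) ltW.
have /andP[p1 p2] : 1 - beta1 <= 1 - beta1 ^+ n.+1 <= 1.
  by rewrite debias_bounds// (ltW b1).
have /andP[r1 r2] : 1 - beta2 <= 1 - beta2 ^+ n.+1 <= 1.
  by rewrite debias_bounds// (ltW b20).
set p := 1 - beta1 ^+ _ in p1 p2 *; set r := 1 - beta2 ^+ _ in r1 r2 vh0 *.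
have p0 : 0 < p by apply: lt_le_trans p1; rewrite subr_gt0.
have r0 : 0 < r by apply: lt_le_trans r1; rewrite subr_gt0.
have vh1 : v n.+1 <= r^-1 * v n.+1 by rewrite ler_peMl// invf_ge1.
have vh2 : 0 < r^-1 * v n.+1 by rewrite lt0r vh0 mulr_ge0// invr_ge0 ltW.
rewrite normrM normfV (ger0_norm (sqrtr_ge0 _)) ler_pdivrMr ?sqrtr_gt0//.
rewrite normrM normfV (gtr0_norm p0) mulrC ler_pdivrMr//.
apply: le_trans (hc _ _ _ hm hv n.+1) _.
have h1 : Num.sqrt (v n.+1) <= Num.sqrt (r^-1 * v n.+1) by rewrite ler_wsqrtr.
apply: (@le_trans _ _ (c * Num.sqrt (r^-1 * v n.+1))); first by rewrite ler_wpM2l.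
rewrite mulrAC ler_wpM2r ?sqrtr_ge0// -mulrA ler_peMr//.
by rewrite mulrC ler_pdivlMr ?mul1r// subr_gt0.
Qed.

(** When [|g n|] dominates the lag error, the debiased moment has the sign of [g n] and a comparable
    size, while the denominator is [O(|g n|)]. Otherwise the product is small because the direction
    is bounded. *)
Lemma adam_dir_descent (R : realType) (beta1 beta2 K : R) :
  0 < beta1 -> beta1 < Num.sqrt beta2 -> beta2 < 1 -> 0 <= K ->
  exists c C : R, [/\ 0 < c, 0 <= C & forall g m v : nat -> R,
    ema beta1 g m -> ema beta2 (fun n => g n ^+ 2) v ->
    (forall n, `|g n.+1 - g n| <= K / Num.sqrt n.+1%:R) ->
    forall n, c * `|g n| - C / Num.sqrt n.+1%:R <= g n * adam_dir beta1 beta2 m v n].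
Proof.
move=> b1 b12 b2 K0; have [C1 C10 hC1] := adam_dir_bounded b1 b12 b2.
have b20 : 0 < beta2 by rewrite -sqrtr_gt0 (lt_trans b1).
have b11 : beta1 < 1 by rewrite (lt_trans b12)// -sqrtr1 ltr_sqrt.
have b1_ : 0 <= beta1 < 1 by rewrite (ltW b1).
have b2_ : 0 <= beta2 < 1 by rewrite (ltW b20).
have [D1 D10 hD1] := ema_lag b1_ K0.
have [D2 D20 hD2] := sqrt_ema_lag b2_ K0.
pose a := Num.sqrt (1 - beta2).
have a0 : 0 < a by rewrite sqrtr_gt0 subr_gt0.
pose D := Num.max (D1 / (1 - beta1)) D2.
have D0 : 0 <= D by rewrite le_max D20 orbT.
exists (a / 3), (2 * D * (C1 + a / 3)).
have C0 : 0 <= 2 * D * (C1 + a / 3) by rewrite !mulr_ge0// addr_ge0// divr_ge0// ltW.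
split=> // [|g m v hm hv gK n]; first by rewrite divr_gt0.
have s0 : 0 <= (Num.sqrt n.+1%:R)^-1 :> R by rewrite invr_ge0 sqrtr_ge0.
have v0 k : 0 <= v k.
  by apply: ema_ge0 hv k => [|k]; rewrite ?sqr_ge0// (ltW b20) ltW.
have := hC1 _ _ _ hm hv n; have := hD1 _ _ hm gK n; have := hD2 _ _ hv gK n.
case: hv => vz vS.
rewrite /adam_dir.
have /andP[p1 p2] := debias_bounds n b1_.
have /andP[r1 r2] := debias_bounds n b2_.
set p := 1 - beta1 ^+ _ in p1 p2 *; set r := 1 - beta2 ^+ _ in r1 r2 *.
have p0 : 0 < p by apply: lt_le_trans p1; rewrite subr_gt0.
have r0 : 0 < r by apply: lt_le_trans r1; rewrite subr_gt0.
set s := (Num.sqrt _)^-1 in s0 *.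
set x := g n.
have x0 := normr_ge0 x.
(* The default quotient 0 is harmless: a vanishing [v n.+1] forces [g n = 0], since it contains
   [(1 - beta2) * g n ^+ 2]. *)
case: eqP => [vh _ _ _|/eqP vh0 hv hm' hu].
  have /eqP : v n.+1 = 0.
    by move/eqP: vh; rewrite mulf_eq0 invr_eq0 gt_eqF//= => /eqP.
  have h1 : 0 <= beta2 * v n by rewrite mulr_ge0// ltW.
  have h2 : 0 <= (1 - beta2) * g n ^+ 2.
    by rewrite mulr_ge0 ?sqr_ge0// subr_ge0 ltW.
  rewrite vS paddr_eq0//.
  move=> /andP[_]; rewrite !mulf_eq0 subr_eq0 (gt_eqF b2)/= orbb -/x => /eqP ->.
  by rewrite normr0 mulr0 mul0r add0r oppr_le0 mulr_ge0.
set vh := r^-1 * _ in vh0 hu *; set mh := p^-1 * _ in hu *.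
have vhp : 0 < vh by rewrite lt0r vh0 mulr_ge0// invr_ge0 ltW.
set w := Num.sqrt vh in hu *; have w0 : 0 < w by rewrite sqrtr_gt0.
have Dm : `|mh - x| <= D * s.
  have -> : mh - x = (m n.+1 - p * x) / p by rewrite /mh; field; rewrite gt_eqF.
  rewrite normrM normfV (gtr0_norm p0) ler_pdivrMr//; apply: le_trans hm' _.
  rewrite mulrAC ler_wpM2r//.
  apply: (@le_trans _ _ (D * (1 - beta1))); last by rewrite ler_wpM2l.
  by rewrite -ler_pdivrMr ?subr_gt0// le_max lexx.
(* The factor [a = sqrt (1 - beta2)] undoes the debiasing of [v], which enlarges it by at most
   [1 / (1 - beta2)]. *)
have Dw : a * w <= `|x| + D * s.
  have -> : a * w = Num.sqrt ((1 - beta2) / r) * Num.sqrt (v n.+1).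
    have ba : 0 <= 1 - beta2 by rewrite subr_ge0 ltW.
    by rewrite /a /w -!sqrtrM ?divr_ge0 ?(ltW r0)// mulrA.
  apply: (@le_trans _ _ (Num.sqrt (v n.+1))).
    rewrite ler_piMl ?sqrtr_ge0// -[leRHS]sqrtr1 ler_wsqrtr//.
    by rewrite ler_pdivrMr// mul1r.
  apply: le_trans hv _; rewrite lerD2l ler_wpM2r//.
  by rewrite le_max lexx orbT.
set e := D * s in Dm Dw.
have e0 : 0 <= e by rewrite mulr_ge0.
have -> : 2 * D * (C1 + a / 3) * s = 2 * e * (C1 + a / 3) by rewrite /e; ring.
(* Beyond the threshold [2 * e], [x * mh >= |x|^2 / 2] and [a * w <= 3/2 * |x|], whence the constant
   [a / 3]. Below it, the loss is at most [2 * e * C1] and [a / 3 * |x|] at most [2 * e * a / 3]. *)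
have [xs|xl] := leP `|x| (2 * e).
  have h1 : - (`|x| * C1) <= x * (mh / w).
    rewrite lerNl; apply: le_trans (ler_norm _) _; rewrite normrN normrM.
    by rewrite ler_wpM2l.
  have h2 : `|x| * C1 <= 2 * e * C1 by rewrite ler_wpM2r.
  have h3 : a / 3 * `|x| <= a / 3 * (2 * e) by rewrite ler_wpM2l// divr_ge0// ltW.
  lra.
apply: (@le_trans _ _ (a / 3 * `|x|)).
  by rewrite gerBl !mulr_ge0// addr_ge0// divr_ge0// ltW.
rewrite mulrA ler_pdivlMr//.
have h1 : `|x| * `|x| - `|x| * e <= x * mh.
  have -> : x * mh = `|x| * `|x| - x * (x - mh).
    by rewrite -expr2 real_normK ?num_real//; ring.
  rewrite lerD2l lerN2; apply: le_trans (ler_norm _) _; rewrite normrM.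
  by rewrite ler_wpM2l// distrC.
have h2 : a * w * `|x| <= (`|x| + e) * `|x| by rewrite ler_wpM2r.
have h3 : `|x| * (2 * e) <= `|x| * `|x| by rewrite ler_wpM2l// ltW.
rewrite [leLHS](_ : _ = a * w * `|x| / 3); last by ring.
lra.
Qed.

(** * From summed descent to the best iterate *)

Lemma sum_invsqrt_ge (R : rcfType) (n : nat) :
  Num.sqrt n%:R <= \sum_(i < n) (Num.sqrt i.+1%:R)^-1 :> R.
Proof.
have [->|n0] := posnP n; first by rewrite big_ord0 sqrtr0.
have s0 : 0 < Num.sqrt n%:R :> R by rewrite sqrtr_gt0 ltr0n.
apply: (@le_trans _ _ (\sum_(i < n) (Num.sqrt n%:R : R)^-1)).
  rewrite sumr_const card_ord -[leRHS]mulr_natl.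
  by rewrite ler_pdivlMr// -expr2 sqr_sqrtr.
apply: ler_sum => i _; rewrite lef_pV2 ?posrE ?sqrtr_gt0 ?ltr0n//.
by rewrite ler_wsqrtr// ler_nat.
Qed.

Lemma best_iterate_rate (R : realType) (F e : nat -> R) (Fmin c B : R) :
  0 < c -> 0 <= B -> (forall n, Fmin <= F n) ->
  (forall n, F n.+1 <= F n - c * (e n / Num.sqrt n.+1%:R) + B / n.+1%:R) ->
  exists C : R, exists T0 : nat, forall T : nat, (T0 <= T)%N ->
    exists2 t : nat, (t < T)%N & e t <= C * (ln T%:R / Num.sqrt T%:R).
Proof.
(* If e stayed above C ln T / sqrt T, then c (sum_n 1/sqrt n) C ln T / sqrt T would
   exceed the total decrease of F plus B (1 + ln T). *)
move=> c0 B0 Fge FS; have l2 : 0 < ln (2%:R : R) by rewrite ln_gt0// ltr1n.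
pose P := F 0%N - Fmin + B.
have P0 : 0 <= P by rewrite addr_ge0// subr_ge0.
(* From [T >= 2] on, [ln T >= ln 2] lets [P / ln 2 * ln T] absorb the constant [P], which includes
   the additive [B] of the harmonic bound. The final [+ 1] makes the contradiction strict. *)
exists ((P / ln 2%:R + B + 1) / c), 2 => T T2.
set X := _ * _.
have [[t tT et]|noX] := pselect (exists2 t, (t < T)%N & e t <= X); first by exists t.
have eX t : (t < T)%N -> X < e t.
  by move=> tT; rewrite ltNge; apply/negP => et; apply: noX; exists t.
have FT n : (n <= T)%N -> F n <= F 0%N - c * X * \sum_(i < n) (Num.sqrt i.+1%:R)^-1
     + B * \sum_(i < n) i.+1%:R^-1.
  elim: n => [_|n IH nT]; first by rewrite !big_ord0 !mulr0 subr0 addr0.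
  have h : X / Num.sqrt n.+1%:R <= e n / Num.sqrt n.+1%:R.
    by rewrite ler_wpM2r ?invr_ge0 ?sqrtr_ge0// ltW// eX.
  have h' := ler_wpM2l (ltW c0) h.
  rewrite !big_ord_recr /= !mulrDr.
  apply: le_trans (FS n) _.
  rewrite opprD [F 0%N + _]addrA addrACA -[leLHS]addrA lerD ?IH ?(ltnW nT)//.
  by rewrite lerD2r lerN2 -[c * X / _]mulrA.
have T0 : 0 < T%:R :> R by rewrite ltr0n (leq_trans _ T2).
have lT : ln (2%:R : R) <= ln T%:R by rewrite ler_ln ?posrE// ler_nat.
have sT : 0 < Num.sqrt T%:R :> R by rewrite sqrtr_gt0.
have cX : c * X * Num.sqrt T%:R = (P / ln 2%:R + B + 1) * ln T%:R.
  by rewrite /X; field; rewrite !gt_eqF.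
have X0 : 0 <= c * X.
  rewrite -(pmulr_lge0 _ sT) cX mulr_ge0 ?addr_ge0 ?divr_ge0 ?ler01 ?(ltW l2)//.
  exact: le_trans (ltW l2) lT.
have h1 := ler_wpM2l X0 (sum_invsqrt_ge R T).
have h2 : \sum_(i < T) i.+1%:R^-1 <= 1 + ln (T%:R : R).
  by case: T {T2 eX noX X FT lT sT cX X0 h1} T0 => [|T _]; [rewrite ltxx|exact: harmonic_le_ln].
have h3 := ler_wpM2l B0 h2.
have h4 : P <= P / ln 2%:R * ln T%:R.
  by rewrite mulrAC ler_pdivlMr// ler_wpM2l.
have := FT T (leqnn T); have := Fge T.
rewrite cX in h1.
have lT0 := lt_le_trans l2 lT.
rewrite /P in h1 h4 *; lra.
Qed.

(** * The MoFO trajectory read coordinate by coordinate *)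

Lemma mofo_moment (R : realType) (d B : nat) grad (blk : 'I_d -> 'I_B)
    (alpha beta1 beta2 : R) lr theta0 i :
  let s := mofo grad blk alpha beta1 beta2 lr theta0 in
  ema beta1 (fun n => grad (s n).1.1 0 i) (fun n => (s n).1.2 0 i).
Proof.
move=> s; split=> [|n]; first by rewrite mxE.
by rewrite /s /=; case: (mofo _ _ _ _ _ _ _ n) => [[th m] v] /=; rewrite !mxE.
Qed.

Lemma mofo_second_moment (R : realType) (d B : nat) grad (blk : 'I_d -> 'I_B)
    (alpha beta1 beta2 : R) lr theta0 i :
  let s := mofo grad blk alpha beta1 beta2 lr theta0 in
  ema beta2 (fun n => grad (s n).1.1 0 i ^+ 2) (fun n => (s n).2 0 i).
Proof.
move=> s; split=> [|n]; first by rewrite mxE.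
by rewrite /s /=; case: (mofo _ _ _ _ _ _ _ n) => [[th m] v] /=; rewrite !mxE.
Qed.

Lemma mofo_thetaS (R : realType) (d B : nat) grad (blk : 'I_d -> 'I_B)
    (alpha beta1 beta2 : R) lr theta0 n :
  let s := mofo grad blk alpha beta1 beta2 lr theta0 in
  (s n.+1).1.1 = (s n).1.1 + \row_i (- (lr n.+1 * (FLT blk alpha (s n.+1).1.2 0 i *
     adam_dir beta1 beta2 (fun k => (s k).1.2 0 i) (fun k => (s k).2 0 i) n))).
Proof.
move=> s; rewrite /adam_dir /s /=; case: (mofo _ _ _ _ _ _ _ n) => [[th m] v] /=.
apply/rowP => i; rewrite !mxE; congr (_ - _ * _).
by case: ifP => _; [rewrite mulr0 | rewrite mulrAC mulrC].
Qed.

Lemma FLT_01 (R : realType) (d B : nat) (blk : 'I_d -> 'I_B) (alpha : R) z i :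
  0 <= FLT blk alpha z 0 i <= 1.
Proof. by rewrite mxE; case: ifP => _; rewrite ?ler01 lexx. Qed.

Theorem theorem1 (R : realType) (d B : nat) (blk : 'I_d -> 'I_B)
  (Loss : 'rV[R]_d -> R) (grad : 'rV[R]_d -> 'rV[R]_d)
  (Lstar Lc alpha beta1 beta2 eta : R) (theta0 : 'rV[R]_d) :
  (forall x : 'rV[R]_d, differentiable Loss x) ->
  (forall x h : 'rV[R]_d, 'd Loss x h = \sum_(i < d) grad x 0 i * h 0 i) ->
  (forall x : 'rV[R]_d, Lstar <= Loss x) ->
  (forall x y : 'rV[R]_d, l2norm (grad x - grad y) <= Lc * l2norm (x - y)) ->
  0 < alpha <= 1 ->
  0 < beta1 -> beta1 < Num.sqrt beta2 -> beta2 < 1 ->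
  0 < eta ->
  exists C : R, exists T0 : nat, forall T : nat, (T0 <= T)%N ->
    exists2 t : nat, (t < T)%N &
      linfnorm (grad (mofo_theta grad blk alpha beta1 beta2
                        (fun s => eta / Num.sqrt (s%:R)) theta0 t))
      <= C * (ln (T%:R) / Num.sqrt (T%:R)).
Proof.
move=> dL gE Lge gL /andP[a0 _] b1 b12 b2 eta0.
set st := mofo grad blk alpha beta1 beta2 (fun s => eta / Num.sqrt s%:R) theta0.
have b20 : 0 < beta2 by rewrite -sqrtr_gt0 (lt_trans b1).
have b11 : beta1 < 1 by rewrite (lt_trans b12)// -sqrtr1 ltr_sqrt.
have b1_ : 0 <= beta1 < 1 by rewrite (ltW b1).
have [C1 C10 hC1] := adam_dir_bounded b1 b12 b2.
(* Each coordinate moves by at most [eta * C1 / sqrt (n + 1)] in one step, so [K / sqrt (n + 1)]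
   bounds the drift of each gradient coordinate. *)
pose K := `|Lc| * d%:R * (eta * C1).
have K0 : 0 <= K by rewrite !mulr_ge0// ltW.
have [c [C [c0 C0 hC]]] := adam_dir_descent b1 b12 b2 K0.
have [D D0 hD] := ema_lag b1_ K0.
pose u n i := adam_dir beta1 beta2 (fun k => (st k).1.2 0 i) (fun k => (st k).2 0 i) n.
pose flt n i := FLT blk alpha (st n.+1).1.2 0 i.
pose g n i := grad (st n).1.1 0 i.
pose s n : R := (Num.sqrt n.+1%:R)^-1.
pose h n : 'rV[R]_d := \row_i (- (eta * s n * (flt n i * u n i))).
have thS n : (st n.+1).1.1 = (st n).1.1 + h n by exact: mofo_thetaS.
have s0 n : 0 < s n by rewrite invr_gt0 sqrtr_gt0.
have s2 n : s n ^+ 2 = n.+1%:R^-1 by rewrite exprVn sqr_sqrtr.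
have u1 n i : `|u n i| <= C1.
  exact: hC1 (mofo_moment _ _ _ _ _ _ _ _) (mofo_second_moment _ _ _ _ _ _ _ _) n.
have es n : 0 <= eta * s n by rewrite mulr_ge0 ?ltW.
have h1 n i : `|h n 0 i| <= eta * s n * C1.
  have /andP[f0 f1] := FLT_01 blk alpha (st n.+1).1.2 i.
  rewrite mxE normrN normrM (ger0_norm (es n)).
  rewrite ler_wpM2l// normrM ger0_norm//.
  by rewrite -[leRHS]mul1r ler_pM.
have es0 n : 0 <= eta * s n * C1 by rewrite mulr_ge0.
have gK i n : `|g n.+1 i - g n i| <= K * s n.
  rewrite /K [_ * _ * s n](_ : _ = `|Lc| * d%:R * (eta * s n * C1)); last by ring.
  apply: (lipschitz_coord gL) => // j.
  by rewrite thS mxE addrAC subrr add0r.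
have hgu n i : c * `|g n i| - C * s n <= g n i * u n i.
  exact: hC (mofo_moment _ _ _ _ _ _ _ _) (mofo_second_moment _ _ _ _ _ _ _ _)
     (gK i) n.
have hm n i : `|(st n.+1).1.2 0 i - (1 - beta1 ^+ n.+1) * g n i| <= D * s n.
  exact: hD (mofo_moment _ _ _ _ _ _ _ i) (gK i) n.
(* Both errors have order [s n ^+ 2]: the lag term of [adam_dir_descent], charged to all [d]
   coordinates since filter entries are at most 1, and the quadratic term of [descent]. *)
pose B0 := eta * d%:R * C + `|Lc| * d%:R ^+ 2 * (eta * C1) ^+ 2.
have B00 : 0 <= B0.
  apply: addr_ge0; first by rewrite !mulr_ge0// ltW.
  by apply: mulr_ge0; [apply: mulr_ge0 => //; exact: sqr_ge0 | exact: sqr_ge0].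
have step n : Loss (st n.+1).1.1 <=
    Loss (st n).1.1 - eta * s n * c * (\sum_(i < d) flt n i * `|g n i|) + B0 * s n ^+ 2.
  rewrite thS; apply: le_trans (descent dL gE gL _ (es0 n) (h1 n)) _.
  rewrite -!addrA lerD2l.
  rewrite [leRHS](_ : _ = - (eta * s n * c * (\sum_(i < d) flt n i * `|g n i|))
    + eta * s n * (d%:R * (C * s n)) + `|Lc| * d%:R ^+ 2 * (eta * s n * C1) ^+ 2);
    last by rewrite /B0; ring.
  rewrite lerD2r.
  have -> : d%:R * (C * s n) = \sum_(i < d) C * s n.
    by rewrite sumr_const card_ord mulr_natl.
  rewrite !mulr_sumr -sumrN -big_split /=; apply: ler_sum => i _.
  rewrite mxE -/(g n i).
  have /andP[f0 f1] : 0 <= flt n i <= 1 by exact: FLT_01.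
  rewrite -[leRHS]opprK lerNr.
  rewrite [leLHS](_ : _ = eta * s n * (flt n i * (c * `|g n i|) - C * s n)); last by ring.
  rewrite [leRHS](_ : _ = eta * s n * (flt n i * (g n i * u n i))); last by ring.
  rewrite ler_wpM2l//.
  apply: (@le_trans _ _ (flt n i * (c * `|g n i| - C * s n))); last by rewrite ler_wpM2l.
  by rewrite mulrBr lerD2l lerN2 ler_piMl// mulr_ge0// ltW.
(* The extra term pays for passing from the gradient at the selected coordinate to the largest
   gradient coordinate. *)
pose B1 := B0 + eta * c * (2 * D / (1 - beta1)).
have B1ge : B0 <= B1.
  rewrite lerDl; apply: mulr_ge0; first by rewrite mulr_ge0// ltW.
  by apply: divr_ge0; [apply: mulr_ge0 | rewrite subr_ge0 ltW].
apply: (@best_iterate_rate R (fun n => Loss (st n).1.1)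
  (fun n => linfnorm (grad (st n).1.1)) Lstar (eta * c) B1) => //.
- by rewrite mulr_gt0.
- exact: le_trans B1ge.
move=> n; rewrite -s2 -/(s n).
have esc : 0 < eta * c * s n by rewrite !mulr_gt0.
have fg0 i : 0 <= flt n i * `|g n i|.
  by rewrite mulr_ge0//; have /andP[] := FLT_01 blk alpha (st n.+1).1.2 i.
rewrite -lerBlDr lerBrDl -lerBrDr -/(linfnorm _).
set Y := leRHS.
suff : linfnorm (grad (st n).1.1) <= Y / (eta * c * s n).
  by rewrite ler_pdivlMr// mulrCA.
have BB : B0 * s n ^+ 2 <= B1 * s n ^+ 2 by rewrite ler_wpM2r ?sqr_ge0.
(* The default value 0 of the maximum has to be bounded as well; this follows from [step], the
   filtered sum being nonnegative. *)
apply: bigmax_le => [|j _]; rewrite ler_pdivlMr//.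
  rewrite mul0r /Y.
  have := step n.
  have : 0 <= eta * s n * c * (\sum_(i < d) flt n i * `|g n i|).
    by rewrite !mulr_ge0 ?sumr_ge0// ltW.
  lra.
have [i [fi mi]] := FLT_some_argmax blk (st n.+1).1.2 j a0.
have sumi : `|g n i| <= \sum_(i < d) flt n i * `|g n i|.
  rewrite (bigD1 i)//= [flt n i]fi mul1r lerDl.
  by apply: sumr_ge0 => k _; exact: fg0.
(* Both moments lie within [D * s n] of [p] times their gradients and [|m|] is maximal at [i];
   dividing by [p >= 1 - beta1] gives the constant. *)
have gij : `|g n j| <= `|g n i| + 2 * D / (1 - beta1) * s n.
  have /andP[p1 _] := debias_bounds n b1_.
  set p := 1 - beta1 ^+ n.+1 in p1 *.
  have p0 : 0 < p by apply: lt_le_trans p1; rewrite subr_gt0.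
  have pg : p * `|g n j| <= p * `|g n i| + 2 * D * s n.
    have hi := hm n i; have hj := hm n j; have mji := mi j.
    have := lerB_dist (p * g n j) ((st n.+1).1.2 0 j).
    have := lerB_dist ((st n.+1).1.2 0 i) (p * g n i).
    rewrite distrC in hj.
    rewrite !(normrM p) (gtr0_norm p0); lra.
  rewrite -(ler_pM2l p0) mulrDr; apply: le_trans pg _; rewrite lerD2l.
  rewrite mulrA; apply: ler_wpM2r; first exact: ltW.
  rewrite mulrA ler_pdivlMr ?subr_gt0//.
  by rewrite mulrC ler_wpM2r// mulr_ge0.
have gsum : eta * s n * c * `|g n j| <= eta * s n * c *
    (\sum_(i < d) flt n i * `|g n i| + 2 * D / (1 - beta1) * s n).
  rewrite ler_wpM2l//; first by rewrite mulr_ge0// ltW.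
  apply: le_trans gij _.
  by rewrite lerD2r.
rewrite mulrDr in gsum.
have EB : B1 * s n ^+ 2 =
    B0 * s n ^+ 2 + eta * s n * c * (2 * D / (1 - beta1) * s n) by rewrite /B1; ring.
have := step n; rewrite /Y EB -/(g n j).
rewrite [`|g n j| * _](_ : _ = eta * s n * c * `|g n j|); last by ring.
lra.
Qed.
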